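(* The $q=2$ Delta Potts interaction family $\mathfrak{I}^{2\text{-Potts}}$ and the Parity Ising interaction family $\mathfrak{I}^{\mathrm{Par\text{-}Is}}$ are not isomorphic as interaction families.
   Context: An interaction family $\mathfrak{I}=(S,\{\Phi^k\}_{k\in\mathbb{Z}_{\ge 0}})$ consists of a finite set $S$ (the spin value set) and functions $\Phi^k\colon S^k\to\mathbb{C}$ that are invariant under permutation of their $k$ arguments. Two interaction families $(S,\{\Phi^k\})$ and $(S',\{\Psi^k\})$ are isomorphic if there is a bijection $f\colon S\to S'$ such that for every $k\in\mathbb{Z}_{\ge0}$ there are constants $\alpha_k,\beta_k$ (in $\mathbb{C}$) with $\Phi^k(s_1,\dots,s_k)=\alpha_k\,\Psi^k(f(s_1),\dots,f(s_k))+\beta_k$ for all $(s_1,\dots,s_k)\in S^k$. Parity Ising family $\mathfrak{I}^{\mathrm{Par\text{-}Is}}$: $S=\{-1,1\}$ and $\Phi^k(s_1,\dots,s_k)=\prod_{i=1}^k s_i$. $q$-state Delta Potts family $\mathfrak{I}^{q\text{-Potts}}$ ($q$ a positive integer): $S=[q]=\{1,\dots,q\}$ and $\Phi^k(s_1,\dots,s_k)=1$ if $s_i=s_j$ for all $i,j\in[k]$, and $0$ otherwise. *)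

(* Defs.v *)
From HB Require Import structures.
From mathcomp Require Import all_boot all_order all_algebra all_fingroup.
From mathcomp Require Import reals complex.

Set Implicit Arguments.
Unset Strict Implicit.
Unset Printing Implicit Defensive.

Import GRing.Theory Num.Theory.
Local Open Scope ring_scope.

(* The field of complex numbers is [R[i]] for a model [R] of the reals. *)
Record interaction_family (R : realType) := InteractionFamily {
  spin : finType;
  interaction : forall k : nat, k.-tuple spin -> R[i];
  interaction_sym : forall (k : nat) (p : 'S_k) (s : k.-tuple spin),
    interaction [tuple tnth s (p i) | i < k] = interaction s
}.

(* The constants may depend on [k] and may vanish; in particular the relation
   is not symmetric by construction. *)
Definition isomorphic (R : realType) (F G : interaction_family R) : Prop :=
  exists f : spin F -> spin G, bijective f /\
    forall k : nat, exists alpha beta : R[i], forall s : k.-tuple (spin F),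
      interaction s = alpha * interaction [tuple f (tnth s i) | i < k] + beta.

(* The spin value set {-1, 1}, as a finite subtype of [int]. *)
Definition ising_spin : finType := seq_sub [:: -1; 1 : int].

Definition parity_interaction (R : realType) (k : nat)
    (s : k.-tuple ising_spin) : R[i] :=
  \prod_(i < k) (ssval (tnth s i))%:~R.

Lemma parity_interaction_sym (R : realType) (k : nat) (p : 'S_k)
    (s : k.-tuple ising_spin) :
  parity_interaction R [tuple tnth s (p i) | i < k] = parity_interaction R s.
Proof.
rewrite /parity_interaction [RHS](reindex_inj (@perm_inj _ p)).
by apply: eq_bigr => i _; rewrite tnth_mktuple.
Qed.

Definition parity_ising (R : realType) : interaction_family R :=
  InteractionFamily (@parity_interaction_sym R).

(* The spin value set {1, ..., q}, as a finite subtype of [nat]. *)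
Definition potts_spin (q : nat) : finType := seq_sub (iota 1 q).

Definition delta_interaction (R : realType) (q k : nat)
    (s : k.-tuple (potts_spin q)) : R[i] :=
  if [forall i : 'I_k, forall j : 'I_k, tnth s i == tnth s j] then 1 else 0.

Lemma delta_interaction_sym (R : realType) (q k : nat) (p : 'S_k)
    (s : k.-tuple (potts_spin q)) :
  delta_interaction R [tuple tnth s (p i) | i < k] = delta_interaction R s.
Proof.
rewrite /delta_interaction; congr (if _ then _ else _).
apply/'forall_forallP/'forall_forallP => eq_s i j.
  by move: (eq_s (p^-1 i)%g (p^-1 j)%g); rewrite !tnth_mktuple !permKV.
by rewrite !tnth_mktuple.
Qed.

Definition delta_potts (R : realType) (q : nat) : interaction_family R :=
  InteractionFamily (@delta_interaction_sym R q).

(* Main.v *)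
Require Import Defs.
From mathcomp Require Import all_boot all_algebra.
From mathcomp Require Import reals complex.

Import GRing.Theory.
Local Open Scope ring_scope.

(** Three-body interactions already separate the two families. Ising spins
    square to [1], so the parity interaction of [(x, y, y)] is [x] whatever [y]
    is ([parity_pair_cancel]); in particular it takes the same value at
    [(x, x, x)] and [(x, y, y)], and so does any affine function of it. The Delta
    Potts interaction, however, is [1] at [(a, a, a)] and [0] at [(a, b, b)]
    when [a != b]. Hence no relabelling [f] of the spins and no constants can
    match the two at [k = 3]. *)

Lemma ising_spin_sqr (R : realType) (x : ising_spin) :
  (ssval x)%:~R * (ssval x)%:~R = 1 :> R[i].
Proof.
rewrite -intrM; case: x => x /=.
by rewrite !inE => /orP[] /eqP ->.
Qed.

Lemma parity_pair_cancel (R : realType) (s : 3.-tuple ising_spin) :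
  tnth s 1 = tnth s 2 -> parity_interaction R s = (ssval (tnth s 0))%:~R.
Proof.
move=> eq_s12; rewrite /parity_interaction !big_ord_recl big_ord0 mulr1.
have -> : lift ord0 ord0 = 1 :> 'I_3 by apply: val_inj.
have -> : lift ord0 (lift ord0 ord0) = 2 :> 'I_3 by apply: val_inj.
by rewrite eq_s12 ising_spin_sqr mulr1.
Qed.

Theorem proposition2p25 (R : realType) :
  ~ isomorphic (delta_potts R 2) (parity_ising R).
Proof.
move=> [f [_ /(_ 3) [alpha [beta affine_f]]]].
pose a : potts_spin 2 := SeqSub (isT : 1%N \in iota 1 2).
pose b : potts_spin 2 := SeqSub (isT : 2%N \in iota 1 2).
have := affine_f [tuple a; b; b]; have := affine_f [tuple a; a; a].
rewrite /= !parity_pair_cancel ?tnth_mktuple //.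
have -> : tnth [tuple a; b; b] 0 = tnth [tuple a; a; a] 0 by [].
move=> <-.
have -> : delta_interaction R [tuple a; a; a] = 1.
  rewrite /delta_interaction ifT //; apply/'forall_forallP => i j.
  by case: i j => [[|[|[|//]]] ?] [[|[|[|//]]] ?].
have -> : delta_interaction R [tuple a; b; b] = 0.
  by rewrite /delta_interaction ifF //; apply/negP => /'forall_forallP/(_ 0 1).
by move/eqP; rewrite eq_sym oner_eq0.
Qed.
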